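(* Let $\mathcal H$ be a complex separable infinite-dimensional Hilbert space, and let $T\in L(\mathcal H)$ and $f_0\in\mathcal H$ be such that $(T^nf_0)_{n\in\mathbb N}$ is an overcomplete frame for $\mathcal H$. Then for each $f\in\mathcal H$ we have $$T^nf\to0\qquad\text{and}\qquad(T^* )^nf\to0\quad\text{as }n\to\infty.$$ In particular, $(T^nf_0)_{n\in\mathbb N}$ does not contain any infinite Riesz sequence, i.e., no infinite subsequence of $(T^nf_0)_{n\in\mathbb N}$ is a Riesz sequence.
   Context: $\mathbb N=\{0,1,2,\dots\}$. $L(\mathcal H)$ is the set of bounded linear operators on $\mathcal H$. A system $(f_n)_{n\in I}$ is a frame for $\mathcal H$ if there are $A,B>0$ with $A\|f\|^2\le\sum_{n\in I}|\langle f,f_n\rangle|^2\le B\|f\|^2$ for all $f\in\mathcal H$. A frame is overcomplete if it is not a Riesz basis. A Riesz sequence is a sequence that is a Riesz basis for its closed linear span. *)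

(* Defs.v *)
From HB Require Import structures.
From mathcomp Require Import all_boot all_order all_algebra.
From mathcomp Require Import sesquilinear complex.
From mathcomp Require Import all_classical all_reals all_analysis.
Import Order.TTheory GRing.Theory Num.Theory.
Import numFieldNormedType.Exports.

Set Implicit Arguments.
Unset Strict Implicit.
Unset Printing Implicit Defensive.

Local Open Scope classical_set_scope.
Local Open Scope ring_scope.

(* The complex numbers are [R[i]] for a [realType R].  A complex Hilbert space
   is a complete normed module [H] over [R[i]] with a form
   [dot : {dot H for Num.conj}] (sesquilinear, linear in the first argument,
   Hermitian and positive definite) that induces the norm of [H]. *)

Section Hilbert.
Context {R : realType}.

(* Norms over [R[i]] take values in [R[i]]; their imaginary part is zero. *)
Definition rnorm {V : normedZmodType R[i]} (x : V) : R := complex.Re `|x|.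

Context {H : completeNormedModType R[i]}.
Implicit Types (M : set H) (f e : nat -> H).

Definition norm_induced (dot : {dot H for Num.conj}) : Prop :=
  forall x : H, `|x| ^+ 2 = dot x x.

Definition bounded_operator (T : {linear H -> H}) : Prop :=
  exists C : R, forall x : H, rnorm (T x) <= C * rnorm x.

(* By the Riesz representation theorem the set below is a singleton when [T]
   is a bounded operator; the default value 0 is then irrelevant. *)
Definition adjoint (dot : {dot H for Num.conj}) (T : H -> H) (y : H) : H :=
  xget 0 [set z | forall x : H, dot (T x) y = dot x z].

Definition lspan f : set H :=
  [set x | exists (n : nat) (c : nat -> R[i]), x = \sum_(i < n) c i *: f i].

Definition closed_lspan f : set H := closure (lspan f).

Definition orthonormal_basis_of (dot : {dot H for Num.conj}) M e : Prop :=
  (forall i j : nat, dot (e i) (e j) = (i == j)%:R) /\ closed_lspan e = M.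

(* For a closed subspace [M]: [f] is the image of an orthonormal basis of [M]
   under a bounded bijective operator of [M].  That operator is given as the
   restriction to [M] of a bounded operator of [H]; this is no loss, since an
   operator of [M] extends to [H] by 0 on the orthogonal complement of [M]. *)
Definition riesz_basis_of (dot : {dot H for Num.conj}) M f : Prop :=
  exists (e : nat -> H) (U : {linear H -> H}),
    [/\ orthonormal_basis_of dot M e, bounded_operator U, set_bij M M U
      & forall n, f n = U (e n)].

Definition riesz_basis (dot : {dot H for Num.conj}) f : Prop :=
  riesz_basis_of dot setT f.

Definition riesz_sequence (dot : {dot H for Num.conj}) f : Prop :=
  riesz_basis_of dot (closed_lspan f) f.

Definition frame (dot : {dot H for Num.conj}) f : Prop :=
  exists A B : R, [/\ 0 < A, 0 < B & forall x : H,
    ((A * rnorm x ^+ 2)%:E <= \sum_(0 <= n <oo) (rnorm (dot x (f n)) ^+ 2)%:E)%E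
    /\
    (\sum_(0 <= n <oo) (rnorm (dot x (f n)) ^+ 2)%:E <= (B * rnorm x ^+ 2)%:E)%E].

Definition overcomplete_frame (dot : {dot H for Num.conj}) f : Prop :=
  frame dot f /\ ~ riesz_basis dot f.

End Hilbert.

Definition separable (X : topologicalType) : Prop :=
  exists D : set X, countable D /\ dense D.

Definition infinite_dimensional (K : fieldType) (V : lmodType K) : Prop :=
  forall (n : nat) (b : 'I_n -> V),
    exists x : V, forall c : 'I_n -> K, x <> \sum_(i < n) c i *: b i.

(* Main.v *)
Require Import Defs.
From HB Require Import structures.
From mathcomp Require Import all_boot all_order all_algebra.
From mathcomp Require Import sesquilinear complex.
From mathcomp Require Import all_classical all_reals all_analysis.
From mathcomp Require Import ring lra.
Import Order.TTheory GRing.Theory Num.Theory.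
Import numFieldNormedType.Exports.
Local Open Scope classical_set_scope.
Local Open Scope ring_scope.

(** Let [e] be an orthonormal basis of [H] and [D] the synthesis operator
    [D (e n) = T^n f0]; it intertwines [T] with the unilateral shift [S] along
    [e], that is [T D = D S].  The frame property makes [D D^*] bounded below,
    so [D] is onto, and [D] is not injective because the frame is not a Riesz
    basis.  Hence [ker D] is a nonzero [S]-invariant closed subspace, and it
    contains a unit vector [c] orthogonal to [S (ker D)].  The vectors [S^p c]
    are orthonormal in [ker D], so subtracting the projections of [e n] on
    [S^p c], [p <= n], does not change [D (e n) = T^n f0]; what is left has
    squared norm [1 - sum_(j <= n) |<c, e j>|^2], which tends to [0].  As
    [T^n D = D S^n] with [S] isometric, [T^n] tends to [0] strongly.  For the
    adjoint, the lower frame bound controls [(T^* )^n y] by the tail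
    [sum_(k >= n) |<y, T^k f0>|^2].  Finally a Riesz sequence is bounded away
    from [0], by the bounded inverse theorem. *)

Set Implicit Arguments.
Unset Strict Implicit.
Unset Printing Implicit Defensive.

(** * Real-valued norms and convergence *)

Section RealNorm.
Context {R : realType}.
Implicit Types (a b : R[i]).

Lemma rnormE (V : normedZmodType R[i]) (x : V) : `|x| = (rnorm x)%:C%C.
Proof. by rewrite /rnorm RRe_real ?normr_real. Qed.

Lemma rnorm_ge0 (V : normedZmodType R[i]) (x : V) : 0 <= rnorm x.
Proof. by rewrite -ler0c -rnormE normr_ge0. Qed.

Lemma rnorm_eq0 (V : normedZmodType R[i]) (x : V) : rnorm x = 0 -> x = 0.
Proof. by move=> h; apply/eqP; rewrite -normr_eq0 rnormE h. Qed.

Lemma rnorm0 (V : normedZmodType R[i]) : rnorm (0 : V) = 0.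
Proof. by apply: complexI; rewrite -rnormE normr0. Qed.

Lemma rnorm_gt0 (V : normedZmodType R[i]) (x : V) : x <> 0 -> 0 < rnorm x.
Proof.
by move=> x0; rewrite lt_def rnorm_ge0 andbT; apply/eqP => /rnorm_eq0.
Qed.

Lemma rnormN (V : normedZmodType R[i]) (x : V) : rnorm (- x) = rnorm x.
Proof. by rewrite /rnorm normrN. Qed.

Lemma rnorm_distC (V : normedZmodType R[i]) (x y : V) :
  rnorm (x - y) = rnorm (y - x).
Proof. by rewrite /rnorm distrC. Qed.

Lemma ler_rnormD (V : normedZmodType R[i]) (x y : V) :
  rnorm (x + y) <= rnorm x + rnorm y.
Proof. by rewrite -lecR rmorphD /= -!rnormE ler_normD. Qed.

Lemma ler_rnormB (V : normedZmodType R[i]) (x y : V) :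
  rnorm (x - y) <= rnorm x + rnorm y.
Proof. by rewrite -(rnormN y) ler_rnormD. Qed.

Lemma rnormM a b : rnorm (a * b) = rnorm a * rnorm b.
Proof. by apply: complexI; rewrite rmorphM /= -!rnormE normrM. Qed.

Lemma rnormZ (V : normedModType R[i]) a (x : V) :
  rnorm (a *: x) = rnorm a * rnorm x.
Proof. by apply: complexI; rewrite rmorphM /= -!rnormE normrZ. Qed.

Lemma rnorm_conj a : rnorm (Num.conj a) = rnorm a.
Proof. by rewrite /rnorm norm_conjC. Qed.

Lemma rnormR (r : R) : rnorm (r%:C%C : R[i]) = `|r|.
Proof.
apply: complexI; rewrite -rnormE normc_def /= expr0n /= addr0.
by rewrite sqrtr_sqr.
Qed.

Lemma conjM_rnorm a : a * Num.conj a = ((rnorm a) ^+ 2)%:C%C.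
Proof. by rewrite -normCK rnormE rmorphXn. Qed.

Lemma ler_rnorm_sum (V : normedZmodType R[i]) (I : Type) (r : seq I)
  (P : pred I) (F : I -> V) :
  rnorm (\sum_(i <- r | P i) F i) <= \sum_(i <- r | P i) rnorm (F i).
Proof.
elim/big_rec2: _ => [|i x y _ h]; first by rewrite rnorm0.
by rewrite (le_trans (ler_rnormD _ _)) // lerD2l.
Qed.

End RealNorm.

(** * Convergence with real tolerances *)

Section Convergence.
Context {R : realType}.

(** Tolerances are taken in [R], so that estimates stay in a totally ordered field; [rcvgP]
    identifies this with convergence along [\oo]. *)
Definition rcvg {V : normedZmodType R[i]} (u : nat -> V) (l : V) : Prop :=
  forall e : R, 0 < e -> exists N, forall n, (N <= n)%N -> rnorm (u n - l) < e.

Lemma rcvg_le {V W : normedZmodType R[i]} (C : R) (u : nat -> V) l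
    (v : nat -> W) m :
  (forall n, rnorm (v n - m) <= C * rnorm (u n - l)) -> rcvg u l -> rcvg v m.
Proof.
move=> h ul e e0.
(* [C] may be zero or negative, so the division is by [Num.max C 1]. *)
have C1 : 0 < Num.max C 1 by rewrite lt_max ltr01 orbT.
have [N hN] := ul (e / Num.max C 1) (divr_gt0 e0 C1).
exists N => n /hN; rewrite ltr_pdivlMr // mulrC => hn.
rewrite (le_lt_trans (h n)) // (le_lt_trans _ hn) //.
by rewrite ler_wpM2r ?rnorm_ge0 // le_max lexx.
Qed.

Lemma rcvgD {V : normedZmodType R[i]} (u v : nat -> V) l m :
  rcvg u l -> rcvg v m -> rcvg (fun n => u n + v n) (l + m).
Proof.
move=> ul vm e e0.
have e2 : 0 < e / 2 by lra.
have [N hN] := ul _ e2; have [M hM] := vm _ e2.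
exists (maxn N M) => n; rewrite geq_max => /andP[/hN hn /hM hm].
rewrite opprD addrACA (le_lt_trans (ler_rnormD _ _)) //; lra.
Qed.

Lemma rcvgN {V : normedZmodType R[i]} (u : nat -> V) l :
  rcvg u l -> rcvg (fun n => - u n) (- l).
Proof. by apply: (rcvg_le (C := 1)) => n; rewrite mul1r -opprD rnormN. Qed.

Lemma rcvgZ {V : normedModType R[i]} (a : R[i]) (u : nat -> V) l :
  rcvg u l -> rcvg (fun n => a *: u n) (a *: l).
Proof. by apply: (rcvg_le (C := rnorm a)) => n; rewrite -scalerBr rnormZ. Qed.

Lemma rcvg_cst {V : normedZmodType R[i]} (N : nat) (u : nat -> V) l :
  (forall n, (N <= n)%N -> u n = l) -> rcvg u l.
Proof. by move=> h e e0; exists N => n /h->; rewrite subrr rnorm0. Qed.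

Lemma rcvg_uniq {V : normedZmodType R[i]} (u : nat -> V) l m :
  rcvg u l -> rcvg u m -> l = m.
Proof.
move=> ul um; apply/eqP/negPn/negP => /eqP lm.
have e0 : 0 < rnorm (l - m) / 2.
  by rewrite divr_gt0 //; apply: rnorm_gt0 => /eqP; rewrite subr_eq0 => /eqP.
have [N hN] := ul _ e0; have [M hM] := um _ e0.
have := hN (maxn N M) (leq_maxl _ _); have := hM (maxn N M) (leq_maxr _ _).
set w := u _ => h1 h2.
have : rnorm (l - m) <= rnorm (w - m) + rnorm (w - l).
  have -> : l - m = (w - m) - (w - l) by rewrite opprB [RHS]addrC subrKA.
  exact: ler_rnormB.
lra.
Qed.

Lemma rcvg_le_rnorm {V : normedZmodType R[i]} (u : nat -> V) l (K : R) :
  rcvg u l -> (forall n, rnorm (u n) <= K) -> rnorm l <= K.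
Proof.
move=> ul uK; rewrite leNgt; apply/negP => lK.
have [|N /(_ _ (leqnn _)) hN] := ul (rnorm l - K); first by lra.
have : rnorm l <= rnorm (u N) + rnorm (u N - l).
  by rewrite -{1}(subKr (u N) l) ler_rnormB.
by have := uK N; lra.
Qed.

Lemma gt0_realc (e : R[i]) :
  0 < e -> 0 < complex.Re e /\ e = (complex.Re e)%:C%C.
Proof. by case: e => a b; rewrite ltcE /= => /andP[/eqP-> ->]. Qed.

Lemma rcvgP {V : pseudoMetricNormedZmodType R[i]} (u : nat -> V) l :
  rcvg u l <-> u @ \oo --> l.
Proof.
split=> [ul|].
  apply/cvgrPdist_lt => e /gt0_realc[e0 ->].
  have [N hN] := ul _ e0; exists N => // n /= /hN.
  by rewrite -ltcR -rnormE distrC.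
move=> /cvgrPdist_lt ul e e0.
have /ul[N _ hN] : (0 : R[i]) < e%:C%C by rewrite ltcR.
by exists N => n /hN /=; rewrite rnormE ltcR rnorm_distC.
Qed.

Lemma rcauchy_cvg {V : completeNormedModType R[i]} (u : nat -> V) :
  (forall e : R, 0 < e -> exists N, forall n, (N <= n)%N ->
     rnorm (u n - u N) < e) ->
  exists l, rcvg u l.
Proof.
move=> uC; suff: cvg (u @ \oo) by move=> uc; exists (lim (u @ \oo)); apply/rcvgP.
apply/cauchy_cvgP/cauchyP => e /gt0_realc[e0 ->].
have [N hN] := uC _ e0; exists (u N); exists N => // n /= /hN h.
by rewrite -ball_normE /= rnormE ltcR rnorm_distC.
Qed.

Lemma closure_rcvg {V : normedModType R[i]} (A : set V) (u : nat -> V) l :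
  (forall n, A (u n)) -> rcvg u l -> closure A l.
Proof.
move=> uA /rcvgP ul B /ul[N _ hN].
by exists (u N); split; [exact: uA | exact: (hN N (leqnn N))].
Qed.

Lemma closure_rnorm {V : normedModType R[i]} (A : set V) x :
  closure A x -> forall e : R, 0 < e -> exists2 y, A y & rnorm (x - y) < e.
Proof.
move=> Ax e e0; have e0' : (0 : R[i]) < e%:C%C by rewrite ltcR.
have [y [Ay]] := Ax _ (nbhsx_ballx x _ e0').
by rewrite -ball_normE /= rnormE ltcR => ?; exists y.
Qed.

Lemma geometric_small (K s e : R) : 0 <= s < 1 -> 0 < e ->
  exists N, forall n, (N <= n)%N -> K * s ^+ n < e.
Proof.
move=> /andP[s0 s1] e0.
have : (fun n => K * s ^+ n) @ \oo --> (K * 0).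
  by apply: cvgMr; apply: cvg_expr; rewrite ger0_norm.
rewrite mulr0 => /cvgrPdist_lt/(_ _ e0)[N _ hN]; exists N => n /hN /=.
by rewrite sub0r normrN; apply: le_lt_trans; exact: ler_norm.
Qed.

Lemma geometric_cvg {V : completeNormedModType R[i]} (u : nat -> V) (K s : R) :
  0 <= s < 1 -> (forall n, rnorm (u n.+1 - u n) <= K * s ^+ n) ->
  exists2 l, rcvg u l & forall n, rnorm (l - u n) <= K * s ^+ n / (1 - s).
Proof.
move=> /andP[s0 s1] uK.
have K0 : 0 <= K by have := le_trans (rnorm_ge0 _) (uK 0%N); rewrite expr0 mulr1.
have H n k : rnorm (u (n + k)%N - u n) <= K * s ^+ n / (1 - s).
  rewrite ler_pdivlMr ?subr_gt0 //.
  (* The induction on [k] needs the exact geometric partial sum; the factor [1 - s ^+ k] is dropped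
     only afterwards. *)
  apply: (@le_trans _ _ (K * s ^+ n * (1 - s ^+ k))); last first.
    rewrite ler_piMr ?mulr_ge0 ?exprn_ge0 //.
    by have := exprn_ge0 k s0; lra.
  elim: k => [|k IH]; first by rewrite addn0 subrr rnorm0 mul0r expr0 subrr mulr0.
  rewrite addnS -(subrKA (u (n + k)%N)).
  have := ler_rnormD (u (n + k).+1 - u (n + k)%N) (u (n + k)%N - u n).
  have := uK (n + k)%N; rewrite exprD exprS.
  set a := rnorm _; set b := rnorm (u (n + k)%N - _); set c := rnorm (_ + _).
  move: IH; rewrite -/b => IH h1 h2.
  have : c * (1 - s) <= (a + b) * (1 - s) by rewrite ler_wpM2r // subr_ge0 ltW.
  have : a * (1 - s) <= K * (s ^+ n * s ^+ k) * (1 - s).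
    by rewrite ler_wpM2r // subr_ge0 ltW.
  by lra.
have [|l ul] := rcauchy_cvg (u := u).
  move=> e e0.
  have s01 : 0 <= s < 1 by rewrite s0.
  have [N hN] := geometric_small (K / (1 - s)) s01 e0.
  exists N => n /subnKC <-; apply: le_lt_trans (H _ _) _.
  by rewrite mulrAC hN.
exists l => // n.
apply: (rcvg_le_rnorm (u := fun k => u (n + k)%N - u n)) => // e e0.
have [N hN] := ul _ e0; exists N => k Nk.
by rewrite opprB addrA subrK hN // (leq_trans Nk) // leq_addl.
Qed.

End Convergence.

Lemma increments_small (R : realType) (u : nat -> R) (K : R) :
  nondecreasing_seq u -> (forall n, u n <= K) ->
  forall e, 0 < e -> exists N, forall n, (N <= n)%N -> u n - u N < e.
Proof.
move=> ui uK e e0.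
have uc : cvgn u by apply: nondecreasing_is_cvgn => //; exists K => _ [n _ <-].
have /cvgrPdist_lt/(_ _ e0)[N _ /(_ N (leqnn _)) /= hN] := uc.
exists N => n _.
have h := nondecreasing_cvgn_le ui uc n.
by rewrite (le_lt_trans _ hN) // (le_trans _ (ler_norm _)) // lerD2r.
Qed.

(** * Inner products and Bessel sequences *)

Section InnerProduct.
Context {R : realType} {H : completeNormedModType R[i]}.
Context (dot : {dot H for Num.conj}) (Hnorm : norm_induced dot).
Implicit Types (x y z : H) (a b : R[i]) (e f : nat -> H) (B : R).

Lemma dotC x y : dot x y = Num.conj (dot y x).
Proof. by rewrite hermC /= expr0 mul1r. Qed.

Lemma dotDl x y z : dot (x + y) z = dot x z + dot y z.
Proof. exact: linearDl. Qed.

Lemma dotBl x y z : dot (x - y) z = dot x z - dot y z.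
Proof. exact: linearBl. Qed.

Lemma dotBr x y z : dot x (y - z) = dot x y - dot x z.
Proof. exact: linearBr. Qed.

Lemma dot0l x : dot 0 x = 0.
Proof. exact: linear0l. Qed.

Lemma dot0r x : dot x 0 = 0.
Proof. exact: linear0r. Qed.

Lemma dotZl a x y : dot (a *: x) y = a * dot x y.
Proof. exact: linearZl_LR. Qed.

Lemma dotZr a x y : dot x (a *: y) = Num.conj a * dot x y.
Proof. exact: linearZr_LR. Qed.

Lemma dot_suml (I : Type) (r : seq I) (P : pred I) (F : I -> H) x :
  dot (\sum_(i <- r | P i) F i) x = \sum_(i <- r | P i) dot (F i) x.
Proof. exact: linear_sumlz. Qed.

Lemma dot_sumr (I : Type) (r : seq I) (P : pred I) (F : I -> H) x :
  dot x (\sum_(i <- r | P i) F i) = \sum_(i <- r | P i) dot x (F i).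
Proof. exact: linear_sumr. Qed.

Lemma dot_self x : dot x x = (rnorm x ^+ 2)%:C%C.
Proof. by rewrite -Hnorm rnormE rmorphXn. Qed.

Lemma dot_self_eq0 x : dot x x = 0 -> x = 0.
Proof.
rewrite dot_self => /complexI/eqP; rewrite sqrf_eq0 => /eqP.
exact: rnorm_eq0.
Qed.

Lemma dot_inj x y : (forall z, dot z x = dot z y) -> x = y.
Proof.
move=> xy; apply/subr0_eq/dot_self_eq0; by rewrite dotBr !xy subrr.
Qed.

Lemma sqr_rnormB x y :
  rnorm (x - y) ^+ 2 = rnorm x ^+ 2 + rnorm y ^+ 2 - 2 * complex.Re (dot x y).
Proof.
apply: complexI.
have -> : (rnorm x ^+ 2 + rnorm y ^+ 2 - 2 * complex.Re (dot x y))%:C%C =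
    dot x x + dot y y - (dot x y + (dot x y)^*%C).
  by rewrite addcJ !dot_self; simpc.
rewrite -dot_self dotBl !dotBr (dotC y x).
by rewrite -[Num.conj _]/(conjc _); ring.
Qed.

Lemma dot_rnorm x y : rnorm (dot x y) <= rnorm x * rnorm y.
Proof.
have [->|y0] := eqVneq y 0; first by rewrite dot0r !rnorm0 mulr0.
set c := dot x y; set N := rnorm y ^+ 2.
have N0 : 0 < N by rewrite exprn_gt0 // rnorm_gt0 //; apply/eqP.
(* With [N = |y|^2] and [c = <x, y>], expanding [|N x - c y|^2 >= 0] gives
   [N (N |x|^2 - |c|^2) >= 0]. *)
have := sqr_rnormB (N%:C%C *: x) (c *: y).
rewrite dotZl dotZr -/c (mulrC (Num.conj c)) conjM_rnorm -rmorphM /= !rnormZ.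
rewrite rnormR gtr0_norm // !exprMn -/N => h.
have : 0 <= N * (N * rnorm x ^+ 2 - rnorm c ^+ 2).
  rewrite (_ : _ * _ = N ^+ 2 * rnorm x ^+ 2 + rnorm c ^+ 2 * N
                        - 2 * (N * rnorm c ^+ 2)); last by ring.
  by rewrite -h sqr_ge0.
rewrite pmulr_rge0 // subr_ge0 => h2.
rewrite -ler_sqr ?nnegrE ?mulr_ge0 ?rnorm_ge0 //.
by rewrite exprMn mulrC.
Qed.

Lemma rcvg_dotl (u : nat -> H) l y :
  rcvg u l -> rcvg (fun n => dot (u n) y) (dot l y).
Proof.
by apply: (rcvg_le (C := rnorm y)) => n; rewrite -dotBl mulrC dot_rnorm.
Qed.

Lemma rcvg_dotr (u : nat -> H) l y :
  rcvg u l -> rcvg (fun n => dot y (u n)) (dot y l).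
Proof.
by apply: (rcvg_le (C := rnorm y)) => n; rewrite -dotBr dot_rnorm.
Qed.

Definition orthonormal_seq e := forall i j, dot (e i) (e j) = (i == j)%:R.

Definition bessel f B :=
  forall x n, \sum_(i < n) rnorm (dot x (f i)) ^+ 2 <= B * rnorm x ^+ 2.

Definition psum e n x : H := \sum_(i < n) dot x (e i) *: e i.

Lemma psum_dot e n x i : orthonormal_seq e ->
  dot (psum e n x) (e i) = if (i < n)%N then dot x (e i) else 0.
Proof.
move=> oe; rewrite /psum dot_suml.
under eq_bigr => j _ do rewrite dotZl oe.
case: ifPn => [ltin|nlt]; last first.
  rewrite big1 // => j _; case: eqP => [E|]; rewrite ?mulr0 //.
  by rewrite -E ltn_ord in nlt.
rewrite (bigD1 (Ordinal ltin)) //= eqxx mulr1 big1 ?addr0 // => j.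
by rewrite -val_eqE /= => /negPf ->; rewrite mulr0.
Qed.

Lemma sqr_rnorm_psumB e n x : orthonormal_seq e ->
  rnorm (x - psum e n x) ^+ 2 =
  rnorm x ^+ 2 - \sum_(i < n) rnorm (dot x (e i)) ^+ 2.
Proof.
move=> oe; rewrite sqr_rnormB.
have xs : dot x (psum e n x) = (\sum_(i < n) rnorm (dot x (e i)) ^+ 2)%:C%C.
  rewrite rmorph_sum dot_sumr; apply: eq_bigr => i _.
  by rewrite dotZr mulrC conjM_rnorm.
have ss : dot (psum e n x) (psum e n x) = dot x (psum e n x).
  rewrite {2 3}/psum !dot_sumr; apply: eq_bigr => i _.
  by rewrite !dotZr psum_dot // ltn_ord.
have -> : rnorm (psum e n x) ^+ 2 = \sum_(i < n) rnorm (dot x (e i)) ^+ 2.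
  by apply: complexI; rewrite -dot_self ss.
by rewrite xs /=; ring.
Qed.

Lemma orthonormal_bessel e : orthonormal_seq e -> bessel e 1.
Proof.
move=> oe x n; rewrite mul1r -subr_ge0 -sqr_rnorm_psumB //; exact: sqr_ge0.
Qed.

Lemma bessel_ge0 f B x : bessel f B -> 0 <= B * rnorm x ^+ 2.
Proof. by move=> /(_ x 0%N); rewrite big_ord0. Qed.

(** Dual form of the Bessel bound: [<y, y>] expands into the coefficients [<y, f i>], whose squares
    are controlled by [|y|^2], and half of [|y|^2] is absorbed. An arbitrary list [r] of indices
    lets it apply to tails. *)
Lemma bessel_sum f B (c : nat -> R[i]) (r : seq nat) : 0 < B ->
  (forall x, \sum_(i <- r) rnorm (dot x (f i)) ^+ 2 <= B * rnorm x ^+ 2) ->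
  rnorm (\sum_(i <- r) c i *: f i) ^+ 2 <= B * \sum_(i <- r) rnorm (c i) ^+ 2.
Proof.
move=> B0 fB; set y := \sum_(i <- r) _.
have h1 : rnorm y ^+ 2 <= \sum_(i <- r) rnorm (c i) * rnorm (dot y (f i)).
  have -> : rnorm y ^+ 2 = rnorm (dot y y).
    by rewrite dot_self rnormR ger0_norm // sqr_ge0.
  rewrite {2}/y dot_sumr (le_trans (ler_rnorm_sum _ _ _)) //.
  by apply: ler_sum => i _; rewrite dotZr rnormM rnorm_conj.
(* AM-GM: [2 s t <= B s^2 + t^2 / B] *)
have h2 : \sum_(i <- r) rnorm (c i) * rnorm (dot y (f i)) <=
    (B * \sum_(i <- r) rnorm (c i) ^+ 2 +
     B^-1 * \sum_(i <- r) rnorm (dot y (f i)) ^+ 2) / 2.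
  rewrite !mulr_sumr -big_split mulr_suml /=; apply: ler_sum => i _.
  set s := rnorm (c i); set t := rnorm _.
  have : 0 <= B * (s - B^-1 * t) ^+ 2 by rewrite mulr_ge0 ?sqr_ge0 // ltW.
  have -> : B * (s - B^-1 * t) ^+ 2 = B * s ^+ 2 + B^-1 * t ^+ 2 - 2 * (s * t).
    by field; rewrite gt_eqF.
  by lra.
have h3 : B^-1 * \sum_(i <- r) rnorm (dot y (f i)) ^+ 2 <= rnorm y ^+ 2.
  by rewrite ler_pdivrMl.
lra.
Qed.

Lemma bessel_tail f B x (m n : nat) : bessel f B ->
  \sum_(m <= i < n) rnorm (dot x (f i)) ^+ 2 <= B * rnorm x ^+ 2.
Proof.
move=> fB; have [mn|nm] := leqP m n; last first.
  by rewrite big_geq ?(ltnW nm) // (bessel_ge0 x fB).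
have := fB x n; rewrite -(big_mkord xpredT (fun i => rnorm (dot x (f i)) ^+ 2)).
rewrite (big_cat_nat (leq0n m) mn) //=; apply: le_trans; rewrite lerDr.
by apply: sumr_ge0 => i _; exact: sqr_ge0.
Qed.

(** The sums of [|c i|^2] increase and are bounded, so their increments become small; [bessel_sum]
    on the tails then makes the vector sums Cauchy. *)
Lemma bessel_series f B (c : nat -> R[i]) (K : R) : 0 < B -> bessel f B ->
  (forall n, \sum_(i < n) rnorm (c i) ^+ 2 <= K) ->
  exists2 y, rcvg (fun n => \sum_(i < n) c i *: f i) y
    & rnorm y ^+ 2 <= B * K.
Proof.
move=> B0 fB cK.
pose s n := \sum_(i < n) rnorm (c i) ^+ 2.
have sE m n : (m <= n)%N -> s n - s m = \sum_(m <= i < n) rnorm (c i) ^+ 2.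
  move=> mn; rewrite /s -!(big_mkord xpredT (fun i => rnorm (c i) ^+ 2)).
  by rewrite (big_cat_nat (leq0n m) mn) //= addrAC subrr add0r.
have si : nondecreasing_seq s.
  move=> m n mn; rewrite -subr_ge0 sE //.
  by apply: sumr_ge0 => i _; exact: sqr_ge0.
have [|y yl] := rcauchy_cvg (u := fun n => \sum_(i < n) c i *: f i).
  move=> e e0; have [|N hN] := increments_small si cK (e := e ^+ 2 / B).
    by rewrite divr_gt0 ?exprn_gt0.
  exists N => n Nn; rewrite -!(big_mkord xpredT (fun i => c i *: f i)).
  rewrite (big_cat_nat (leq0n N) Nn) //= addrAC subrr add0r.
  rewrite -ltr_sqr ?nnegrE ?rnorm_ge0 ?(ltW e0) //.
  apply: le_lt_trans (bessel_sum c B0 (fun x => bessel_tail x N n fB)) _.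
  by rewrite -sE // mulrC -ltr_pdivlMr // hN.
exists y => //.
have K0 : 0 <= K by have := cK 0%N; rewrite big_ord0.
have BK0 : 0 <= B * K by rewrite mulr_ge0 // ltW.
rewrite -(sqr_sqrtr BK0) ler_sqr ?nnegrE ?rnorm_ge0 ?sqrtr_ge0 //.
apply: rcvg_le_rnorm yl _ => n.
rewrite -ler_sqr ?nnegrE ?rnorm_ge0 ?sqrtr_ge0 // sqr_sqrtr //.
rewrite -(big_mkord xpredT (fun i => c i *: f i)).
apply: le_trans (bessel_sum c B0 (fun x => bessel_tail x 0 n fB)) _.
by rewrite ler_pM2l // big_mkord.
Qed.
End InnerProduct.

(** * Operators defined by Bessel sequences, and adjoints *)

Section BesselOperators.
Context {R : realType} {H : completeNormedModType R[i]}.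
Context (dot : {dot H for Num.conj}) (Hnorm : norm_induced dot).
Implicit Types (x y z : H) (e f : nat -> H) (B C : R).

Lemma bounded_operator_gt0 (T : {linear H -> H}) : bounded_operator T ->
  exists2 C : R, 0 < C & forall x, rnorm (T x) <= C * rnorm x.
Proof.
move=> [C TC]; exists (Num.max C 1); first by rewrite lt_max ltr01 orbT.
move=> x; rewrite (le_trans (TC x)) // ler_wpM2r ?rnorm_ge0 //.
by rewrite le_max lexx.
Qed.

Lemma sqr_bounded_operator (T : {linear H -> H}) (K : R) : 0 <= K ->
  (forall x, rnorm (T x) ^+ 2 <= K * rnorm x ^+ 2) -> bounded_operator T.
Proof.
move=> K0 TK; exists (Num.sqrt K) => x.
rewrite -ler_sqr ?nnegrE ?mulr_ge0 ?sqrtr_ge0 ?rnorm_ge0 //.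
by rewrite exprMn sqr_sqrtr.
Qed.

Lemma rcvg_bounded (T : {linear H -> H}) (u : nat -> H) l :
  bounded_operator T -> rcvg u l -> rcvg (fun n => T (u n)) (T l).
Proof. by move=> [C TC]; apply: (rcvg_le (C := C)) => n; rewrite -linearB. Qed.

(** Analysis along [e] followed by synthesis along [f]. Synthesis operators, their adjoints, the
    shift and orthogonal projections all have this form. *)
Definition sum_operator e f (U : H -> H) : Prop :=
  forall x, rcvg (fun n => \sum_(i < n) dot x (e i) *: f i) (U x).

Lemma sum_operator_exists e f B C : 0 < B -> 0 < C ->
    bessel dot e B -> bessel dot f C ->
  exists U : {linear H -> H}, sum_operator e f U /\ bounded_operator U.
Proof.
move=> B0 C0 eB fC.
have ex x : exists y, rcvg (fun n => \sum_(i < n) dot x (e i) *: f i) y /\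
    rnorm y ^+ 2 <= C * (B * rnorm x ^+ 2).
  have [|y yl yK] := bessel_series Hnorm (c := fun i => dot x (e i)) C0 fC
    (K := B * rnorm x ^+ 2); first exact: eB.
  by exists y.
have [U UP] := choice ex.
have linU : linear U.
  move=> a x y; apply: rcvg_uniq (UP (a *: x + y)).1 _.
  have := rcvgD (rcvgZ a (UP x).1) (UP y).1.
  congr (rcvg _ _); apply/funext => n.
  rewrite scaler_sumr -big_split; apply: eq_bigr => i _ /=.
  by rewrite (dotDl dot) (dotZl dot) scalerDl scalerA.
pose UL : {linear H -> H} := HB.pack U (GRing.isLinear.Build _ _ _ _ _ linU).
exists UL; split; first by move=> x; exact: (UP x).1.
apply: (sqr_bounded_operator (K := C * B)); first by rewrite mulr_ge0 // ltW.
by move=> x; rewrite -mulrA; exact: (UP x).2.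
Qed.

(** Exchanging the two families gives the adjoint, since the partial sums on both sides agree term
    by term. *)
Lemma sum_operator_adjoint e f (U V : H -> H) :
  sum_operator e f U -> sum_operator f e V ->
  forall x y, dot (U x) y = dot x (V y).
Proof.
move=> eU fV x y; apply: rcvg_uniq (rcvg_dotl Hnorm y (eU x)) _.
have := rcvg_dotr Hnorm x (fV y); congr (rcvg _ _); apply/funext => n.
rewrite (dot_suml dot) (dot_sumr dot); apply: eq_bigr => i _.
by rewrite (dotZl dot) (dotZr dot) -(dotC dot) mulrC.
Qed.

Lemma sum_operator_basis e f (U : H -> H) k : orthonormal_seq dot e ->
  sum_operator e f U -> U (e k) = f k.
Proof.
move=> oe eU; apply: rcvg_uniq (eU (e k)) _.
apply: (rcvg_cst (N := k.+1)) => n kn.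
rewrite (bigD1 (Ordinal kn)) //= oe eqxx scale1r big1 ?addr0 // => j.
by rewrite -val_eqE /= eq_sym oe => /negPf->; rewrite scale0r.
Qed.

Definition onb e : Prop :=
  orthonormal_seq dot e /\ forall x, (forall n, dot x (e n) = 0) -> x = 0.

(** The sum operator [U] of [e] with itself is self-adjoint and fixes every [e n], so [x - U x] is
    orthogonal to all of [e]. *)
Lemma onb_expand e x : onb e -> rcvg (fun n => psum dot e n x) x.
Proof.
move=> [oe te]; have be := orthonormal_bessel Hnorm oe.
have [U [eU _]] := sum_operator_exists ltr01 ltr01 be be.
suff {2}-> : x = U x by exact: eU.
apply/subr0_eq/te => n; rewrite (dotBl dot).
rewrite (sum_operator_adjoint eU eU) (sum_operator_basis _ oe eU).
by rewrite subrr.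
Qed.

Lemma onb_ext e (U V : {linear H -> H}) : onb e ->
  bounded_operator U -> bounded_operator V ->
  (forall n, U (e n) = V (e n)) -> forall x, U x = V x.
Proof.
move=> he bU bV UV x.
apply: rcvg_uniq (rcvg_bounded bU (onb_expand x he)) _.
have := rcvg_bounded bV (onb_expand x he); congr (rcvg _ _); apply/funext => n.
by rewrite /psum !linear_sum; apply: eq_bigr => i _ /=; rewrite !linearZ /= UV.
Qed.

Lemma bounded_sum_operator e (T : {linear H -> H}) : onb e ->
  bounded_operator T -> sum_operator e (T \o e) T.
Proof.
move=> he bT x; have := rcvg_bounded bT (onb_expand x he).
congr (rcvg _ _); apply/funext => n.
by rewrite /psum linear_sum; apply: eq_bigr => i _; rewrite linearZ.
Qed.

(** This precedes the existence of adjoints, so [s] is rewritten as [<x, T z>] with [z] the sum of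
    the [<x, T (e i)> e i]. As [|z|^2 <= s], Cauchy-Schwarz gives [s^2 <= C^2 |x|^2 s], and one
    factor [s] cancels. *)
Lemma bessel_image e (T : {linear H -> H}) C : 0 < C ->
  orthonormal_seq dot e -> (forall x, rnorm (T x) <= C * rnorm x) ->
  bessel dot (T \o e) (C ^+ 2).
Proof.
move=> C0 oe TC x n; set s := \sum_(i < n) _.
pose z := \sum_(i < n) dot x (T (e i)) *: e i.
have zs : rnorm z ^+ 2 <= s.
  have := bessel_sum Hnorm (f := e) (r := index_iota 0 n)
    (fun i => dot x (T (e i))) ltr01.
  rewrite mul1r !big_mkord; apply => y.
  by rewrite big_mkord; exact: orthonormal_bessel.
have sE : s = rnorm (dot x (T z)).
  suff -> : dot x (T z) = s%:C%C.
    by rewrite rnormR ger0_norm // sumr_ge0 // => i _; exact: sqr_ge0.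
  rewrite linear_sum (dot_sumr dot) rmorph_sum; apply: eq_bigr => i _ /=.
  by rewrite linearZ /= (dotZr dot) mulrC conjM_rnorm.
have s0 : 0 <= s by rewrite sE rnorm_ge0.
have [->|sn0] := eqVneq s 0; first by rewrite -exprMn sqr_ge0.
have sgt0 : 0 < s by rewrite lt_def sn0.
have h : s <= C * rnorm x * rnorm z.
  rewrite sE (le_trans (dot_rnorm Hnorm _ _)) // mulrC mulrAC.
  by rewrite ler_wpM2r ?rnorm_ge0 // TC.
have : s * s <= C ^+ 2 * rnorm x ^+ 2 * s.
  apply: (@le_trans _ _ (C ^+ 2 * rnorm x ^+ 2 * rnorm z ^+ 2)).
    rewrite -!exprMn -expr2 ler_sqr ?nnegrE ?mulr_ge0 ?rnorm_ge0 //.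
    exact: ltW.
  by rewrite ler_wpM2l // -exprMn sqr_ge0.
by rewrite ler_pM2r.
Qed.

(** The adjoint is explicit: it sends [y] to the sum of the [<y, T (e i)> e i], which converges
    because [T \o e] is Bessel. *)
Lemma adjoint_exists e (T : {linear H -> H}) : onb e -> bounded_operator T ->
  exists S : {linear H -> H}, bounded_operator S /\
    forall x y, dot (T x) y = dot x (S y).
Proof.
move=> he bT; have [C C0 TC] := bounded_operator_gt0 bT.
have be := orthonormal_bessel Hnorm he.1.
have bTe := bessel_image C0 he.1 TC.
have [S [fS bS]] := sum_operator_exists (exprn_gt0 2 C0) ltr01 bTe be.
exists S; split=> //.
exact: sum_operator_adjoint (bounded_sum_operator he bT) fS.
Qed.

Lemma adjointE (T S : H -> H) : (forall x y, dot (T x) y = dot x (S y)) ->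
  adjoint dot T = S.
Proof.
move=> TS; apply/funext => y; rewrite /adjoint; case: xgetP => [z -> zT|/(_ (S y))].
  by apply: (dot_inj Hnorm) => x; rewrite -TS zT.
by case=> x; exact: TS.
Qed.

Lemma iter_adjoint (T S : H -> H) : (forall x y, dot (T x) y = dot x (S y)) ->
  forall n x y, dot (iter n T x) y = dot x (iter n S y).
Proof. by move=> TS; elim=> //= n IH x y; rewrite TS IH -iterSr. Qed.

Lemma lspan_sum f (c : nat -> R[i]) n : lspan f (\sum_(i < n) c i *: f i).
Proof. by exists n, c. Qed.

Lemma onb_closed_lspan e : onb e -> closed_lspan e = setT.
Proof.
move=> he; apply/seteqP; split=> // x _.
apply: closure_rcvg (onb_expand x he) => n.
exact: (lspan_sum e (fun i => dot x (e i))).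
Qed.

End BesselOperators.

(** * Orthonormal bases *)

Section GramSchmidt.
Context {R : realType} {H : completeNormedModType R[i]}.
Context (dot : {dot H for Num.conj}) (Hnorm : norm_induced dot).
Implicit Types (x y z : H) (e : nat -> H).

Definition orthonormal_upto e n :=
  forall i k, (i < n)%N -> (k < n)%N -> dot (e i) (e k) = (i == k)%:R.

Lemma psum_residual_dot e n x i : orthonormal_upto e n -> (i < n)%N ->
  dot (x - psum dot e n x) (e i) = 0.
Proof.
move=> oe ltin; rewrite (dotBl dot) /psum (dot_suml dot).
rewrite (bigD1 (Ordinal ltin)) //= (dotZl dot) oe // eqxx mulr1 big1.
  by rewrite addr0 subrr.
move=> j; rewrite -val_eqE /= => /negPf ji.
by rewrite (dotZl dot) oe // ji mulr0.
Qed.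

Lemma psum_orthogonal e n x y :
  (forall i, (i < n)%N -> dot y (e i) = 0) -> dot y (psum dot e n x) = 0.
Proof.
move=> ye; rewrite (dot_sumr dot) big1 // => i _.
by rewrite (dotZr dot) ye ?mulr0.
Qed.

Variable d : nat -> H.
Hypothesis d_total : forall x, (forall n, dot x (d n) = 0) -> x = 0.

(** Otherwise each [d j] lies in the span of the first [n] vectors [e i]. Then [x - psum dot e n x]
    is orthogonal to all of [d], hence zero, and [n] vectors span [H]. *)
Lemma escape_psum e n : infinite_dimensional H -> orthonormal_upto e n ->
  exists j, d j <> psum dot e n (d j).
Proof.
move=> Hinf oe; apply: contrapT => /forallNP dE.
have [x xE] := Hinf n (fun i => e i).
apply: (xE (fun i => dot x (e i))); apply/subr0_eq/d_total => j.
have -> : d j = psum dot e n (d j) by apply: contrapT; exact: dE.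
by apply: psum_orthogonal => i ltin; exact: psum_residual_dot.
Qed.

(* [e n] is the normalised residual of the first [d j] outside the span of
   its predecessors. *)
Lemma gram_schmidt_seq : infinite_dimensional H ->
  exists e, forall n, orthonormal_upto e n -> exists j,
    [/\ forall i, (i < j)%N -> d i = psum dot e n (d i),
        d j - psum dot e n (d j) <> 0
      & e n = ((rnorm (d j - psum dot e n (d j)))^-1)%:C%C *:
              (d j - psum dot e n (d j))].
Proof.
move=> Hinf.
(* The list [l] holds the vectors built so far. The specification is conditional on their
   orthonormality, so every list has a suitable [v] (by default [0]) and choice applies before
   orthonormality is known. *)
pose P (l : seq H) v := orthonormal_upto (nth 0 l) (size l) -> exists j,
    [/\ forall i, (i < j)%N -> d i = psum dot (nth 0 l) (size l) (d i),
        d j - psum dot (nth 0 l) (size l) (d j) <> 0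
      & v = ((rnorm (d j - psum dot (nth 0 l) (size l) (d j)))^-1)%:C%C *:
            (d j - psum dot (nth 0 l) (size l) (d j))].
have /choice[v vP] : forall l, exists v, P l v.
  move=> l; have [ol|nol] := pselect (orthonormal_upto (nth 0 l) (size l));
    last by exists 0.
  have [j0 j0P] := escape_psum Hinf ol.
  have exj : exists j, `[< d j <> psum dot (nth 0 l) (size l) (d j) >].
    by exists j0; apply/asboolP.
  case: (ex_minnP exj) => j /asboolP jP jmin.
  eexists => _; exists j; split; last reflexivity.
    move=> i ij; apply: contrapT => /asboolP/jmin.
    by rewrite leqNgt ij.
  by move/subr0_eq.
pose l n := iter n (fun l => rcons l (v l)) [::].
pose e n := v (l n).
have lE n : l n = mkseq e n.
  by elim: n => // n IH; rewrite mkseqS -IH.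
exists e => n oe; have nthE i : (i < n)%N -> nth 0 (l n) i = e i.
  by move=> ltin; rewrite lE nth_mkseq.
have sl : size (l n) = n by rewrite lE size_mkseq.
have pE x : psum dot (nth 0 (l n)) (size (l n)) x = psum dot e n x.
  by rewrite sl; apply: eq_bigr => i _; rewrite nthE.
have [|j [jlt jn vE]] := vP (l n).
  by move=> i k; rewrite sl => li lk; rewrite !nthE // oe.
exists j; split; rewrite -?pE // => i ij; rewrite -pE; exact: jlt.
Qed.

Lemma onb_exists : infinite_dimensional H -> exists e, onb dot e.
Proof.
move=> /gram_schmidt_seq[e eP]; exists e.
have oe n : orthonormal_upto e n.
  elim: n => // n IH; have [j [_ w0 enE]] := eP n IH.
  set w := _ - _ in w0 enE.
  have wi i : (i < n)%N -> dot (e n) (e i) = 0.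
    by move=> ltin; rewrite enE (dotZl dot) psum_residual_dot // mulr0.
  have enn : dot (e n) (e n) = 1.
    rewrite dot_self // enE rnormZ rnormR ger0_norm ?invr_ge0 ?rnorm_ge0 //.
    by rewrite mulVf ?expr1n //; apply/eqP => /rnorm_eq0.
  move=> i k; rewrite !ltnS.
  rewrite leq_eqVlt => /predU1P[->|li]; rewrite leq_eqVlt => /predU1P[->|lk].
  - by rewrite enn eqxx.
  - by rewrite wi // gtn_eqF.
  - by rewrite (dotC dot) wi // conjC0 ltn_eqF.
  - exact: IH.
split=> [i k|x xe].
  by apply: (oe (maxn i k).+1); rewrite ltnS ?leq_maxl ?leq_maxr.
have pE n y : psum dot e n.+1 y = psum dot e n y + dot y (e n) *: e n.
  by rewrite /psum big_ord_recr.
have psum_mono n y : y = psum dot e n y -> y = psum dot e n.+1 y.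
  move=> yE; rewrite pE -yE (_ : dot y (e n) = 0) ?scale0r ?addr0 //.
  rewrite yE (dotC dot) psum_orthogonal ?conjC0 // => i ltin.
  by rewrite (oe n.+1) ?gtn_eqF // ltnS ltnW.
(* Each step treats the least index not yet spanned. If [d n] is outside the span of the first [n]
   vectors, that index is [n] itself, and adding [e n] captures [d n]. *)
have span n : forall j, (j < n)%N -> d j = psum dot e n (d j).
  elim: n => // n IH j; rewrite ltnS => ljn.
  have [/psum_mono//|dj] := pselect (d j = psum dot e n (d j)).
  have [k [kP w0 enE]] := eP n (oe n); set w := _ - _ in w0 enE.
  have jn : j = n.
    apply/eqP; rewrite eqn_leq ljn leqNgt; apply/negP => /IH; exact: dj.
  have kj : k = j.
    apply/eqP; rewrite eqn_leq; apply/andP; split.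
      by rewrite leqNgt; apply/negP => /kP.
    rewrite jn leqNgt; apply/negP => /IH h; apply: w0.
    by rewrite /w -h subrr.
  have wn : rnorm w != 0 by apply/eqP => /rnorm_eq0.
  have dw : dot (d k) (e n) = (rnorm w)%:C%C.
    have -> : d k = w + psum dot e n (d k) by rewrite /w subrK.
    rewrite (dotDl dot) [X in _ + X](dotC dot) psum_orthogonal; last first.
      by move=> i ltin; rewrite (oe n.+1) ?gtn_eqF // ltnS ltnW.
    rewrite conjC0 addr0 enE (dotZr dot) dot_self //.
    rewrite -[Num.conj _]/(conjc _) conjc_real -rmorphM /=.
    by rewrite expr2 mulrA mulVf // mul1r.
  rewrite -kj pE dw enE scalerA -rmorphM /= mulfV // scale1r.
  by rewrite /w addrC subrK.
apply: d_total => j; rewrite (span j.+1 j) //.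
by apply: psum_orthogonal => i _.
Qed.

End GramSchmidt.

(** * Coercivity, uniform boundedness and bounded inverses *)

Section Surjectivity.
Context {R : realType} {H : completeNormedModType R[i]}.
Context (dot : {dot H for Num.conj}) (Hnorm : norm_induced dot).
Implicit Types (x y z w : H) (A B C : R).

(* Richardson iteration: the residual of [D D' g = y] is contracted by
   [1 - D D' / B]. *)
Lemma coercive_surjective (D D' : {linear H -> H}) A B : 0 < A -> 0 < B ->
    (forall x y, dot (D x) y = dot x (D' y)) ->
    (forall x, rnorm (D x) ^+ 2 <= B * rnorm x ^+ 2) ->
    (forall x, A * rnorm x ^+ 2 <= rnorm (D' x) ^+ 2) ->
  forall y, exists g, D (D' g) = y.
Proof.
move=> A0 B0 adj DB D'A y.
pose step r := r - (B^-1)%:C%C *: D (D' r).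
(* [1 - A / B] bounds the squared contraction factor of [step]; the maximum with [0] makes its
   square root meaningful. *)
pose q := Num.max 0 (1 - A / B).
have q1 : q < 1 by rewrite gt_max ltr01 gtrBl divr_gt0.
have q0 : 0 <= q by rewrite le_max lexx.
have stepq r : rnorm (step r) <= Num.sqrt q * rnorm r.
  rewrite -ler_sqr ?nnegrE ?mulr_ge0 ?sqrtr_ge0 ?rnorm_ge0 //.
  rewrite exprMn sqr_sqrtr // (@le_trans _ _ ((1 - A / B) * rnorm r ^+ 2)) //;
    last by rewrite ler_wpM2r ?sqr_ge0 // le_max lexx orbT.
  rewrite /step (sqr_rnormB Hnorm) rnormZ rnormR exprMn.
  rewrite ger0_norm ?invr_ge0 ?(ltW B0) // (dotZr dot) (dotC dot) adj.
  rewrite dot_self // -!/(conjc _) -![Num.conj _]/(conjc _) !conjc_real.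
  rewrite -rmorphM /=.
  have h1 : B^-1 ^+ 2 * rnorm (D (D' r)) ^+ 2 <= B^-1 * rnorm (D' r) ^+ 2.
    rewrite expr2 -mulrA ler_pM2l ?invr_gt0 // ler_pdivrMl //; exact: DB.
  have h2 : B^-1 * (A * rnorm r ^+ 2) <= B^-1 * rnorm (D' r) ^+ 2.
    by rewrite ler_pM2l ?invr_gt0.
  rewrite mulrBl mul1r (mulrC A) -(mulrA B^-1 A). lra.
have s01 : 0 <= Num.sqrt q < 1.
  by rewrite sqrtr_ge0 -sqrtr1 ltr_sqrt.
pose r n := iter n step y.
have rK n : rnorm (r n) <= rnorm y * Num.sqrt q ^+ n.
  elim: n => [|n IH]; first by rewrite expr0 mulr1.
  rewrite (le_trans (stepq _)) // exprS mulrCA ler_wpM2l ?sqrtr_ge0 //.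
pose g n := \sum_(j < n) (B^-1)%:C%C *: r j.
have rE n : r n = y - D (D' (g n)).
  elim: n => [|n IH].
    by rewrite [g 0%N]big_ord0 !raddf0 addr0.
  have -> : g n.+1 = g n + (B^-1)%:C%C *: r n by rewrite /g big_ord_recr.
  have -> a c b : D (D' (a + c *: b)) = D (D' a) + c *: D (D' b).
    by rewrite !linearD !linearZ.
  by rewrite opprD addrA -IH.
have [|l gl _] := geometric_cvg (u := g) (K := B^-1 * rnorm y) s01.
  move=> n; rewrite /g big_ord_recr /= addrAC subrr add0r rnormZ rnormR.
  by rewrite ger0_norm ?invr_ge0 ?(ltW B0) // -mulrA ler_pM2l ?invr_gt0 ?rK.
exists l.
have bD : bounded_operator D by apply: (sqr_bounded_operator (ltW B0)).
(* [D'] inherits the bound of [D] through [|D' x|^2 = <D (D' x), x> <= |D (D' x)| |x|]. *)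
have bD' : bounded_operator D'.
  apply: (sqr_bounded_operator (K := B)); first exact: ltW.
  move=> x; have [->|x0] := eqVneq (D' x) 0.
    by rewrite rnorm0 expr0n /= mulr_ge0 ?sqr_ge0 // ltW.
  have : rnorm (D' x) ^+ 2 <= rnorm (D (D' x)) * rnorm x.
    rewrite -[leLHS]ger0_norm ?sqr_ge0 // -rnormR -(dot_self Hnorm) -adj.
    exact: dot_rnorm.
  set a := rnorm (D' x); set b := rnorm (D _); set c := rnorm x => h.
  have a0 : 0 < a by rewrite rnorm_gt0 //; apply/eqP.
  have hb : b ^+ 2 <= B * a ^+ 2 by exact: DB.
  have : (a ^+ 2) ^+ 2 <= (b * c) ^+ 2.
    by rewrite ler_sqr // nnegrE ?sqr_ge0 ?mulr_ge0 ?rnorm_ge0.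
  rewrite [(b * c) ^+ 2]exprMn => h2.
  have h3 : b ^+ 2 * c ^+ 2 <= B * a ^+ 2 * c ^+ 2 by rewrite ler_wpM2r ?sqr_ge0.
  have := le_trans h2 h3.
  by rewrite [(a ^+ 2) ^+ 2]expr2 (mulrAC B) ler_pM2r ?exprn_gt0.
apply: rcvg_uniq (rcvg_bounded bD (rcvg_bounded bD' gl)) _.
have r0 : rcvg r 0.
  move=> e e0; have [N hN] := geometric_small (rnorm y) s01 e0.
  by exists N => n /hN; rewrite subr0; exact: le_lt_trans.
have ry : rcvg (fun _ : nat => y) y by apply: (rcvg_cst (N := 0)).
have := rcvgD ry (rcvgN r0).
rewrite oppr0 addr0; congr (rcvg _ _); apply/funext => n.
by rewrite rE opprB addrC subrK.
Qed.

(* One of [x + v] and [x - v] works, with [v] of norm [t] along [w]; iterating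
   this is Sokal's gliding-hump proof of uniform boundedness. *)
Lemma amplify x w (t : R) : w <> 0 -> 0 <= t ->
  exists x', rnorm (x' - x) <= t /\ t * rnorm w <= rnorm (dot x' w).
Proof.
move=> w0 t0; have wn := rnorm_gt0 w0.
pose v := (t / rnorm w)%:C%C *: w.
have vn : rnorm v = t.
  rewrite rnormZ rnormR ger0_norm ?divr_ge0 ?rnorm_ge0 //.
  by rewrite divfK // gt_eqF.
have vw : rnorm (dot v w) = t * rnorm w.
  rewrite (dotZl dot) rnormM dot_self // !rnormR !ger0_norm ?sqr_ge0 //.
    by rewrite expr2 mulrA divfK // gt_eqF.
  by rewrite divr_ge0 // rnorm_ge0.
have [h|h] := leP (t * rnorm w) (rnorm (dot (x + v) w)).
  by exists (x + v); rewrite addrAC subrr add0r vn.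
exists (x - v); rewrite addrAC subrr add0r rnormN vn; split=> //.
have : rnorm (dot v w + dot v w) <= rnorm (dot (x + v) w) + rnorm (dot (x - v) w).
  rewrite (_ : dot v w + dot v w = dot (x + v) w - dot (x - v) w) ?ler_rnormB //.
  by rewrite (dotDl dot) (dotBl dot); ring.
have -> : dot v w + dot v w = 2%:C%C * dot v w.
  by rewrite rmorph_nat mulr_natl mulr2n.
rewrite rnormM rnormR ger0_norm //.
by rewrite vw; lra.
Qed.

Lemma uniform_boundedness (W : set H) :
  (forall x, exists M, forall w, W w -> rnorm (dot x w) <= M) ->
  exists C, forall w, W w -> rnorm w <= C.
Proof.
move=> Wb; apply: contrapT => /forallNP nb.
(* Step [n] moves the point by at most [4^-n] and makes the pairing with [w n] at least
   [4^-n |w n|]. All later moves add up to at most [4^-n / 3], so the limit still pairs with [w n]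
   to at least [(2/3) 4^-n |w n| > 2n/3]. *)
have /choice[w wP] : forall n, exists w, W w /\ n%:R * 4 ^+ n < rnorm w.
  move=> n; have /existsNP[w /not_implyP[Ww /negP]] := nb (n%:R * 4 ^+ n).
  by rewrite -ltNge => ?; exists w.
have w0 n : w n <> 0.
  move=> E; have := (wP n).2; rewrite E rnorm0 ltNge.
  by rewrite mulr_ge0 ?ler0n ?exprn_ge0.
have /choice[F FP] : forall p : nat * H, exists x',
    rnorm (x' - p.2) <= (4^-1) ^+ p.1 /\
    (4^-1) ^+ p.1 * rnorm (w p.1) <= rnorm (dot x' (w p.1)).
  move=> [n x] /=; apply: amplify; first exact: w0.
  by rewrite exprn_ge0 ?invr_ge0.
pose u := fix u n := if n is k.+1 then F (k, u k) else 0 : H.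
have s01 : 0 <= (4^-1 : R) < 1 by apply/andP; split; lra.
have [|l ul lu] := geometric_cvg (u := u) (K := 1) s01.
  by move=> n; rewrite mul1r; exact: (FP (n, u n)).1.
have [M MP] := Wb l.
pose n := (Num.truncn (2 * `|M|)).+1.
have Mn : 2 * `|M| < n%:R by exact: truncnS_gt.
have := MP _ (wP n).1.
have h1 := (FP (n, u n)).2; rewrite /= -/(u n.+1) in h1.
have h2 := lu n.+1; rewrite mul1r exprS in h2.
have h3 : rnorm (dot (u n.+1) (w n)) <=
          rnorm (dot l (w n)) + rnorm (l - u n.+1) * rnorm (w n).
  apply: le_trans (_ : rnorm (dot l (w n)) + rnorm (dot (l - u n.+1) (w n)) <= _).
    rewrite (dotBl dot).
    by rewrite -{1}(subKr (dot l (w n)) (dot (u n.+1) (w n))) ler_rnormB.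
  by rewrite lerD2l dot_rnorm.
have h4 := (wP n).2.
set t := 4^-1 ^+ n in h1 h2.
have t4 : t * 4 ^+ n = 1 by rewrite -exprMn mulVf ?expr1n.
have t0 : 0 < t by rewrite exprn_gt0 // invr_gt0.
have h5 : n%:R < t * rnorm (w n).
  by move: h4; rewrite -(ltr_pM2l t0) mulrCA t4 mulr1.
have h6 : rnorm (l - u n.+1) * rnorm (w n) <= (t / 3) * rnorm (w n).
  rewrite ler_wpM2r ?rnorm_ge0 // (le_trans h2) //.
  by rewrite ler_pdivrMr; lra.
by have := ler_norm M; have := normr_ge0 M; lra.
Qed.

(** Bounded inverse theorem by duality. Since [U] is onto, the set of [w] with [|S w| <= 1] is
    weakly bounded, hence bounded, so [S] is bounded below. Solving [U (S g) = U x] gives [S g = x]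
    by injectivity, and [|x|^2 = <U x, g> <= |U x| C |x|]. *)
Lemma bounded_below (U S : {linear H -> H}) :
    bounded_operator U -> (forall x y, dot (U x) y = dot x (S y)) ->
    injective U -> (forall y, exists x, U x = y) ->
  exists C, forall x, rnorm x <= C * rnorm (U x).
Proof.
move=> bU adj Ui Us.
have [|C0 WC] := uniform_boundedness (W := [set w | rnorm (S w) <= 1]).
  move=> x; have [z <-] := Us x; exists (rnorm z) => w /= Sw.
  rewrite adj (le_trans (dot_rnorm Hnorm _ _)) //.
  by rewrite ler_piMr ?rnorm_ge0.
pose C := Num.max C0 1; have C1 : 0 < C by rewrite lt_max ltr01 orbT.
have SC w : rnorm w <= C * rnorm (S w).
  have [Sw|Sw] := eqVneq (S w) 0.
    suff -> : w = 0 by rewrite rnorm0 mulr_ge0 ?rnorm_ge0 // ltW.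
    have [z zw] := Us w; apply: (dot_self_eq0 Hnorm).
    by rewrite -{1}zw adj Sw (dot0r dot).
  have Sn : 0 < rnorm (S w) by rewrite rnorm_gt0 //; apply/eqP.
  have := WC (((rnorm (S w))^-1)%:C%C *: w).
  rewrite /= linearZ /= !rnormZ rnormR ger0_norm ?invr_ge0 ?rnorm_ge0 //.
  rewrite mulVf ?gt_eqF // => /(_ (lexx _)).
  rewrite ler_pdivrMl // mulrC => h; rewrite (le_trans h) //.
  by rewrite ler_wpM2r ?rnorm_ge0 // le_max lexx.
exists C => x.
have [K K0 UK] := bounded_operator_gt0 bU.
have [||||g Ug] := @coercive_surjective U S (C ^- 2) (K ^+ 2) _ _ adj _ _ (U x).
- by rewrite invr_gt0 exprn_gt0.
- by rewrite exprn_gt0.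
- by move=> z; rewrite -exprMn ler_sqr ?nnegrE ?mulr_ge0 ?rnorm_ge0 // ltW.
- move=> z; rewrite ler_pdivrMl ?exprn_gt0 // -exprMn.
  by rewrite ler_sqr ?nnegrE ?mulr_ge0 ?rnorm_ge0 // ltW.
have Sg := Ui _ _ Ug.
have [->|x0] := eqVneq x 0; first by rewrite rnorm0 mulr_ge0 ?rnorm_ge0 // ltW.
have xn : 0 < rnorm x by rewrite rnorm_gt0 //; apply/eqP.
have : rnorm x ^+ 2 <= rnorm (U x) * rnorm g.
  rewrite -[leLHS]ger0_norm ?sqr_ge0 // -rnormR -(dot_self Hnorm) -{2}Sg -adj.
  exact: dot_rnorm.
have : rnorm (U x) * rnorm g <= rnorm (U x) * (C * rnorm x).
  by rewrite ler_wpM2l ?rnorm_ge0 // -Sg SC.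
move=> h1 h2; have := le_trans h2 h1.
by rewrite mulrCA mulrA expr2 ler_pM2r.
Qed.

End Surjectivity.

(** * The shift and its wandering vectors *)

Section Shift.
Context {R : realType} {H : completeNormedModType R[i]}.
Context (dot : {dot H for Num.conj}) (Hnorm : norm_induced dot).
Context (e : nat -> H) (he : onb dot e).
Implicit Types (x y z b c : H).

(** [S] sums from [e] to [e \o succ] and its adjoint [S'] sums back; testing [S' (S y) = y] against
    [e] yields the isometry. *)
Lemma shift_exists : exists S : {linear H -> H},
  [/\ bounded_operator S, forall n, S (e n) = e n.+1,
      forall x y, dot (S x) (S y) = dot x y, forall x, dot (S x) (e 0%N) = 0
    & forall x n, dot (S x) (e n.+1) = dot x (e n)].
Proof.
have [oe te] := he.
have oes : orthonormal_seq dot (e \o succn) by move=> i k; exact: oe.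
have be := orthonormal_bessel Hnorm oe.
have bes := orthonormal_bessel Hnorm oes.
have [S [eS bS]] := sum_operator_exists Hnorm ltr01 ltr01 be bes.
have [S' [eS' _]] := sum_operator_exists Hnorm ltr01 ltr01 bes be.
have adj := sum_operator_adjoint Hnorm eS eS'.
have Se n : S (e n) = e n.+1 by rewrite (sum_operator_basis n oe eS).
have Sen x n : dot (S x) (e n.+1) = dot x (e n).
  by rewrite adj (sum_operator_basis n oes eS').
exists S; split=> // [x y|x].
  rewrite adj; suff -> : S' (S y) = y by [].
  apply/subr0_eq/te => n; rewrite (dotBl dot) (dotC dot) -adj Se -(dotC dot).
  by rewrite Sen subrr.
apply: rcvg_uniq (rcvg_dotl Hnorm (e 0%N) (eS x)) _.
apply: (rcvg_cst (N := 0)) => n _; rewrite (dot_suml dot) big1 // => i _.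
by rewrite (dotZl dot) oe mulr0.
Qed.

Variable S : {linear H -> H}.
Hypothesis S_isometry : forall x y, dot (S x) (S y) = dot x y.
Hypothesis S_bottom : forall x, dot (S x) (e 0%N) = 0.
Hypothesis S_succ : forall x n, dot (S x) (e n.+1) = dot x (e n).

(* A nonzero shift-invariant kernel has a wandering vector: for the least [m]
   such that [e m] is not orthogonal to [ker D], take the orthogonal projection
   of [e m] onto [ker D]. *)
Lemma wandering_vector (D D' : {linear H -> H}) b0 :
    (forall x y, dot (D x) y = dot x (D' y)) ->
    (forall y, exists g, D (D' g) = y) ->
    (forall b, D b = 0 -> D (S b) = 0) ->
    D b0 = 0 -> b0 <> 0 ->
  exists c, [/\ dot c c = 1, D c = 0 & forall b, D b = 0 -> dot (S b) c = 0].
Proof.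
move=> adj surj DS Db0 b00.
have exm : exists m, `[< exists b, D b = 0 /\ dot b (e m) <> 0 >].
  apply: contrapT => /forallNP h; apply/b00/he.2 => n.
  by apply: contrapT => bn; apply: (h n); apply/asboolP; exists b0.
case: (ex_minnP exm) => m /asboolP[b1 [Db1 b1m]] mmin.
(* For [m = 0] the range of [S] is orthogonal to [e 0]; otherwise the coefficient equals that of [b]
   at [m - 1], zero by minimality. *)
have Sm b : D b = 0 -> dot (S b) (e m) = 0.
  case: m mmin {exm b1m} => [|m] mmin Db; first exact: S_bottom.
  rewrite S_succ; apply: contrapT => bm.
  suff /mmin : `[< exists b, D b = 0 /\ dot b (e m) <> 0 >] by rewrite ltnn.
  by apply/asboolP; exists b.
have [g Dg] := surj (D (e m)).
(* The range of [D'] is orthogonal to the kernel of [D], so removing [D' g] leaves the projection of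
   [e m] onto that kernel. *)
pose c := e m - D' g.
have Dc : D c = 0 by rewrite linearB /= Dg subrr.
have cE b : D b = 0 -> dot b c = dot b (e m).
  by move=> Db; rewrite (dotBr dot) -adj Db (dot0l dot) subr0.
have c0 : c <> 0 by move=> E; apply: b1m; rewrite -cE // E (dot0r dot).
have Sc b : D b = 0 -> dot (S b) c = 0 by move=> Db; rewrite cE ?Sm ?DS.
exists (((rnorm c)^-1)%:C%C *: c); split.
- rewrite (dot_self Hnorm) rnormZ rnormR ger0_norm ?invr_ge0 ?rnorm_ge0 //.
  by rewrite mulVf ?expr1n //; apply/eqP => /rnorm_eq0.
- by rewrite linearZ /= Dc scaler0.
- by move=> b Db; rewrite (dotZr dot) Sc // mulr0.
Qed.

Lemma shift_orbit_orthonormal c : dot c c = 1 ->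
  (forall p, dot (S (iter p S c)) c = 0) ->
  orthonormal_seq dot (fun p => iter p S c).
Proof.
move=> c1 Sc; elim=> [|i IH] [|k] /=.
- by rewrite c1.
- by rewrite (dotC dot) Sc conjC0.
- by rewrite Sc.
- by rewrite S_isometry IH.
Qed.

(* Subtracting from [e n] its projections on the shifts of a unit wandering
   vector [c] of [ker D] does not change [D (e n)], and leaves the norm of the
   tail of [c]. *)
Lemma wandering_decay (D : {linear H -> H}) c : bounded_operator D ->
    (forall b, D b = 0 -> D (S b) = 0) -> dot c c = 1 -> D c = 0 ->
    (forall b, D b = 0 -> dot (S b) c = 0) ->
  rcvg (D \o e) 0.
Proof.
move=> [C DC] DS c1 Dc Sc.
pose u p := iter p S c.
have Du p : D (u p) = 0 by elim: p => //= p IH; rewrite DS.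
have ou : orthonormal_seq dot u.
  by apply: shift_orbit_orthonormal => // p; exact/Sc/Du.
have ue p k : dot (u p) (e (p + k)%N) = dot c (e k).
  by elim: p => //= p IH; rewrite addSn S_succ IH.
have rn x : dot x x = 1 -> rnorm x ^+ 2 = 1.
  by move=> x1; apply: complexI; rewrite -(dot_self Hnorm).
have nE n : rnorm (e n - psum dot u n.+1 (e n)) =
    rnorm (c - psum dot e n.+1 c).
  apply/eqP; rewrite -(eqrXn2 (n := 2)) ?rnorm_ge0 //; apply/eqP.
  rewrite (sqr_rnorm_psumB Hnorm) // (sqr_rnorm_psumB Hnorm); last exact: he.1.
  rewrite !rn //; last by rewrite he.1 eqxx.
  (* The coefficient of [e n] on [u (n - i)] is the conjugate of [<c, e i>], so reversing the index
     matches the two sums. *)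
  congr (_ - _); rewrite (reindex_inj rev_ord_inj); apply: eq_bigr => i _ /=.
  rewrite subSS (dotC dot) rnorm_conj.
  have in_ : (i <= n)%N by rewrite -ltnS.
  by have := ue (n - i)%N i; rewrite subnK // => ->.
apply: (rcvg_le (C := C) (u := fun n => c - psum dot e n.+1 c) (l := 0)); last first.
  move=> r r0; have [N hN] := onb_expand Hnorm c he r0.
  by exists N => n Nn; rewrite subr0 rnorm_distC hN // leqW.
move=> n; rewrite !subr0 -nE /=; apply: le_trans (DC _).
rewrite linearB linear_sum big1 /= ?subr0 // => i _.
by rewrite linearZ /= Du scaler0.
Qed.

End Shift.

(** * Orbits that are frames *)

Section FrameOrbit.
Context {R : realType} {H : completeNormedModType R[i]}.
Context (dot : {dot H for Num.conj}) (Hnorm : norm_induced dot).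
Implicit Types (x y z : H) (f : nat -> H).

(** Extended-real series are replaced by finite sums: the lower bound is tested against any [K] that
    dominates all partial sums. *)
Lemma frame_bounds f : frame dot f -> exists A B : R,
  [/\ 0 < A, 0 < B, bessel dot f B & forall x K,
      (forall n, \sum_(i < n) rnorm (dot x (f i)) ^+ 2 <= K) ->
      A * rnorm x ^+ 2 <= K].
Proof.
move=> [A [B [A0 B0 fAB]]]; exists A, B; split=> // [x n|x K xK].
  rewrite -lee_fin; apply: le_trans (fAB x).2.
  rewrite -sumEFin.
  rewrite -(big_mkord xpredT (fun i => (rnorm (dot x (f i)) ^+ 2)%:E)).
  by apply: nneseries_lim_ge => i _ _; rewrite lee_fin sqr_ge0.
rewrite -lee_fin; apply: le_trans (fAB x).1 _; apply: lime_le.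
  by apply: is_cvg_nneseries => i _ _; rewrite lee_fin sqr_ge0.
by apply: nearW => n; rewrite sumEFin lee_fin big_mkord.
Qed.

Lemma frame_total f : frame dot f ->
  forall x, (forall n, dot x (f n) = 0) -> x = 0.
Proof.
move=> /frame_bounds[A [B [A0 _ _ low]]] x xf; apply: rnorm_eq0.
have : A * rnorm x ^+ 2 <= 0.
  by apply: low => n; rewrite big1 // => i _; rewrite xf rnorm0 expr0n.
rewrite pmulr_rle0 // => h; apply/eqP; rewrite -sqrf_eq0.
by rewrite eq_le h sqr_ge0.
Qed.

Lemma analysis_lower_bound e f (A : R) (D D' : H -> H) : onb dot e ->
    (forall x y, dot (D x) y = dot x (D' y)) -> (forall n, D (e n) = f n) ->
    (forall x K, (forall n, \sum_(i < n) rnorm (dot x (f i)) ^+ 2 <= K) ->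
      A * rnorm x ^+ 2 <= K) ->
  forall x, A * rnorm x ^+ 2 <= rnorm (D' x) ^+ 2.
Proof.
move=> he adj De low x; apply: low => n.
rewrite -[leRHS]mul1r; apply: le_trans (orthonormal_bessel Hnorm he.1 _ n).
apply: ler_sum => i _; rewrite (dotC dot x) (dotC dot (D' x)) !rnorm_conj.
by rewrite -De adj.
Qed.

Lemma adjoint_orbit_vanishes (T S : H -> H) (f0 y : H) :
    infinite_dimensional H -> frame dot (fun n => iter n T f0) ->
    (forall x y, dot (T x) y = dot x (S y)) ->
  rcvg (fun n => iter n S y) 0.
Proof.
move=> Hinf fr adj; set f := fun n => iter n T f0 in fr.
have [A [B [A0 B0 fB low]]] := frame_bounds fr.
have [e he] := onb_exists Hnorm (frame_total fr) Hinf.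
have be := orthonormal_bessel Hnorm he.1.
have [D [eD _]] := sum_operator_exists Hnorm ltr01 B0 be fB.
have [D' [fD' _]] := sum_operator_exists Hnorm B0 ltr01 fB be.
have adjD := sum_operator_adjoint Hnorm eD fD'.
have De n : D (e n) = f n by rewrite (sum_operator_basis n he.1 eD).
pose r m := D' y - psum dot e m (D' y).
(* The frame coefficients of [iter m S y] are [<y, f (m + i)> = <D' y, e (m + i)>], which are
   coordinates of the remainder [r m]. *)
have tail m : A * rnorm (iter m S y) ^+ 2 <= rnorm (r m) ^+ 2.
  apply: low => n.
  have oem : orthonormal_seq dot (fun i => e (m + i)%N).
    by move=> i k; rewrite he.1 eqn_add2l.
  rewrite -[leRHS]mul1r; apply: le_trans (orthonormal_bessel Hnorm oem _ n).
  apply: ler_sum => i _; rewrite (dotC dot) -(iter_adjoint adj) -iterD.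
  rewrite -/(f (m + i)%N) -De adjD -(dotC dot) /r (dotBl dot).
  by rewrite (psum_dot _ _ _ he.1) ltnNge leq_addr /= subr0.
apply: (rcvg_le (C := Num.sqrt A^-1) (u := r) (l := 0)); last first.
  move=> d d0; have [N hN] := onb_expand Hnorm (D' y) he d0.
  by exists N => n Nn; rewrite subr0 rnorm_distC hN.
move=> m; rewrite !subr0 -ler_sqr ?nnegrE ?mulr_ge0 ?sqrtr_ge0 ?rnorm_ge0 //.
rewrite exprMn sqr_sqrtr ?invr_ge0 ?(ltW A0) //.
by rewrite mulrC ler_pdivlMr // mulrC tail.
Qed.

Lemma overcomplete_orbit_vanishes (T : {linear H -> H}) (f0 y : H) :
    infinite_dimensional H -> bounded_operator T ->
    overcomplete_frame dot (fun n => iter n T f0) ->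
  rcvg (fun n => iter n T y) 0.
Proof.
move=> Hinf bT [fr nriesz]; set f := fun n => iter n T f0 in fr nriesz.
have [A [B [A0 B0 fB low]]] := frame_bounds fr.
have [e he] := onb_exists Hnorm (frame_total fr) Hinf.
have be := orthonormal_bessel Hnorm he.1.
have [D [eD bD]] := sum_operator_exists Hnorm ltr01 B0 be fB.
have [D' [fD' _]] := sum_operator_exists Hnorm B0 ltr01 fB be.
have adj := sum_operator_adjoint Hnorm eD fD'.
have De n : D (e n) = f n by rewrite (sum_operator_basis n he.1 eD).
have DB x : rnorm (D x) ^+ 2 <= B * rnorm x ^+ 2.
  have [|z Dz zB] := bessel_series Hnorm (c := fun i => dot x (e i)) B0 fB
    (K := rnorm x ^+ 2); first by move=> n; rewrite -[leRHS]mul1r; exact: be.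
  by rewrite (rcvg_uniq (eD x) Dz).
have surj := coercive_surjective Hnorm A0 B0 adj DB
  (analysis_lower_bound he adj De low).
have [S [bS Se S_iso S_bot S_succ]] := shift_exists Hnorm he.
have [C C0 DC] := bounded_operator_gt0 bD.
have TDS x : T (D x) = D (S x).
  pose L := [the {linear H -> H} of T \o D].
  pose M := [the {linear H -> H} of D \o S].
  have [CT CT0 TC] := bounded_operator_gt0 bT.
  have [CS _ SC] := bounded_operator_gt0 bS.
  have bL : bounded_operator L.
    exists (CT * C) => z; rewrite (le_trans (TC _)) // -mulrA.
    by rewrite ler_pM2l.
  have bM : bounded_operator M.
    exists (C * CS) => z; rewrite (le_trans (DC _)) // -mulrA.
    by rewrite ler_pM2l.
  by apply: (onb_ext Hnorm he bL bM) => n; rewrite /= Se !De.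
have DS b : D b = 0 -> D (S b) = 0 by move=> Db; rewrite -TDS Db linear0.
have Dsurj z : exists x, D x = z by have [g gE] := surj z; exists (D' g).
(* With a trivial kernel [D] would be a bounded bijection carrying [e] to the frame, which would
   then be a Riesz basis. *)
have [b [Db b0]] : exists b, D b = 0 /\ b <> 0.
  apply: contrapT => /forallNP kerD; apply: nriesz; exists e, D; split=> //.
    by split; [exact: he.1 | exact: onb_closed_lspan].
  split=> // [x z _ _ Dxz|z _].
    apply: subr0_eq; apply: contrapT => xz; apply: (kerD (x - z)); split=> //.
    by rewrite linearB /= Dxz subrr.
  by have [x <-] := Dsurj z; exists x.
have [c [c1 Dc Sc]] := wandering_vector Hnorm he S_bot S_succ adj surj DS Db b0.
have Dvan := wandering_decay Hnorm he S_iso S_succ bD DS c1 Dc Sc.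
have [x <-] := Dsurj y.
have iterD n z : iter n T (D z) = D (iter n S z).
  by elim: n => //= n ->; rewrite TDS.
have S_rnorm n z : rnorm (iter n S z) = rnorm z.
  elim: n => //= n <-; apply/eqP; rewrite -(eqrXn2 (n := 2)) ?rnorm_ge0 //.
  by apply/eqP/complexI; rewrite -!(dot_self Hnorm) S_iso.
have S_lin n a z w : iter n S (z + a *: w) = iter n S z + a *: iter n S w.
  by elim: n => //= n ->; rewrite linearD linearZ.
have S_basis n k : iter n S (e k) = e (n + k)%N by elim: n => //= n ->.
have head k : rcvg (fun n => D (iter n S (psum dot e k x))) 0.
  elim: k => [|k IH].
    apply: (rcvg_cst (N := 0)) => n _.
    rewrite [psum _ _ _ _]big_ord0.
    suff -> : iter n S 0 = 0 by rewrite linear0.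
    by elim: n => //= n ->; rewrite linear0.
  have Dk : rcvg (fun n => D (e (n + k)%N)) 0.
    move=> d d0; have [N hN] := Dvan d d0.
    by exists N => n Nn; apply: hN; rewrite (leq_trans Nn) // leq_addr.
  have := rcvgD IH (rcvgZ (dot x (e k)) Dk); rewrite scaler0 addr0.
  congr (rcvg _ _); apply/funext => n.
  by rewrite /psum big_ord_recr /= S_lin S_basis linearD linearZ.
(* Half of [d] is spent on the remainder of [x] after [k] terms: as [S] is isometric, its image has
   norm at most [C] times that of the remainder, uniformly in [n]. The other half goes to the finite
   part. *)
move=> d d0; have d2 : 0 < d / (2 * C) by rewrite divr_gt0 // mulr_gt0.
have [k hk] := onb_expand Hnorm x he d2.
have d3 : 0 < d / 2 by rewrite divr_gt0.
have [N hN] := head k _ d3; exists N => n /hN; rewrite !subr0 iterD => hn.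
have -> : iter n S x = iter n S (psum dot e k x) +
    1 *: iter n S (x - psum dot e k x).
  by rewrite -S_lin scale1r addrC subrK.
rewrite scale1r linearD (le_lt_trans (ler_rnormD _ _)) //.
have : rnorm (D (iter n S (x - psum dot e k x))) < C * (d / (2 * C)).
  by rewrite (le_lt_trans (DC _)) // S_rnorm ltr_pM2l // rnorm_distC hk.
rewrite (_ : C * _ = d / 2); last by field; rewrite gt_eqF.
by lra.
Qed.

End FrameOrbit.

(** * Riesz bases are bounded away from zero *)

Section RieszBasis.
Context {R : realType} {H : completeNormedModType R[i]}.
Context (dot : {dot H for Num.conj}) (Hnorm : norm_induced dot).
Implicit Types (x y z : H) (f : nat -> H).

Lemma sum_projection e (P : {linear H -> H}) x : orthonormal_seq dot e ->
  bounded_operator P -> sum_operator dot e e P -> closed_lspan e x -> P x = x.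
Proof.
move=> oe bP eP ex; have [C C0 PC] := bounded_operator_gt0 bP.
apply: subr0_eq; apply: contrapT => Px.
(* [P] fixes the span, so [|P x - x| <= (C + 1) |x - y|] for every [y] in it; a [y] closer than this
   tolerance is contradictory. *)
have d0 : 0 < rnorm (P x - x) / (C + 1).
  by rewrite divr_gt0 ?addr_gt0 // rnorm_gt0.
have [y [n [c yE]]] := closure_rnorm ex d0.
rewrite ltr_pdivlMr ?addr_gt0 // ltNge => /negP; apply.
have Py : P y = y.
  rewrite yE linear_sum; apply: eq_bigr => i _.
  by rewrite linearZ /= (sum_operator_basis i oe eP).
have -> : P x - x = P (x - y) - (x - y) by rewrite linearB Py opprB addrA subrK.
rewrite (le_trans (ler_rnormB _ _)) // mulrDr mulr1 mulrC.
by rewrite lerD2r PC.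
Qed.

(* The operator of the Riesz basis is extended by the identity on the
   orthogonal complement, so that the bounded inverse argument takes place in
   the whole space. *)
Lemma riesz_basis_of_lower_bound b M f : onb dot b -> riesz_basis_of dot M f ->
  exists C : R, forall n, 1 <= C * rnorm (f n).
Proof.
move=> hb [e [U [[oe eM] bU [UM Ui Us] fE]]].
have be := orthonormal_bessel Hnorm oe.
have [P [eP bP]] := sum_operator_exists Hnorm ltr01 ltr01 be be.
have PM x : M (P x).
  rewrite -eM; apply: closure_rcvg (eP x) => n.
  exact: (lspan_sum e (fun i => dot x (e i))).
have Pid x : M x -> P x = x.
  by rewrite -eM => ex; exact: (sum_projection oe bP eP ex).
pose V := [the {linear H -> H} of (U \o P) \+ (idfun \- P)].
have VE x : V x = U (P x) + (x - P x) by [].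
have bV : bounded_operator V.
  have [C C0 UC] := bounded_operator_gt0 bU.
  have [K K0 PK] := bounded_operator_gt0 bP.
  exists (C * K + (1 + K)) => x; rewrite VE (le_trans (ler_rnormD _ _)) //.
  rewrite mulrDl lerD //.
    by rewrite (le_trans (UC _)) // -mulrA ler_pM2l.
  by rewrite (le_trans (ler_rnormB _ _)) // mulrDl mul1r lerD2l.
(* [P] recovers [U (P x)] from [V x]. Injectivity thus reduces to that of [U] on [M], after which
   the complementary parts agree. *)
have PV x : P (V x) = U (P x).
  rewrite VE linearD linearB (Pid _ (PM x)) subrr addr0.
  by apply: Pid; apply: UM.
have Vi : injective V.
  move=> x y Vxy; have Pxy : P x = P y.
    by apply: Ui; rewrite ?inE // -!PV Vxy.
  by move: Vxy; rewrite !VE Pxy => /addrI/addIr.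
have Vs y : exists x, V x = y.
  have [z Mz Uz] := Us _ (PM y).
  exists (z + (y - P y)); rewrite VE linearD linearB (Pid _ (PM y)) subrr addr0.
  by rewrite (Pid _ Mz) Uz [z + _]addrC addrK addrC subrK.
have [S [_ adj]] := adjoint_exists Hnorm hb bV.
have [C VC] := bounded_below Hnorm bV adj Vi Vs.
exists C => n; have := VC (e n).
rewrite VE (sum_operator_basis n oe eP) subrr addr0 -fE.
suff -> : rnorm (e n) = 1 by [].
apply/eqP; rewrite -(eqrXn2 (n := 2)) ?rnorm_ge0 // expr1n.
by apply/eqP/complexI; rewrite -(dot_self Hnorm) oe eqxx.
Qed.

End RieszBasis.

Theorem corollary3p6 (R : realType) (H : completeNormedModType R[i])
  (dot : {dot H for Num.conj}) (Hnorm : norm_induced dot)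
  (Hsep : separable H) (Hinf : infinite_dimensional H)
  (T : {linear H -> H}) (HT : bounded_operator T) (f0 : H)
  (Hover : overcomplete_frame dot (fun n => iter n T f0)) :
  (forall f : H,
     (fun n => iter n T f) @ \oo --> (0 : H) /\
     (fun n => iter n (adjoint dot T) f) @ \oo --> (0 : H)) /\
  (forall phi : nat -> nat, (forall m n : nat, (m < n)%N -> (phi m < phi n)%N) ->
     ~ riesz_sequence dot (fun n => iter (phi n) T f0)).
Proof.
have [e he] := onb_exists Hnorm (frame_total Hover.1) Hinf.
have Tvan y := overcomplete_orbit_vanishes Hnorm y Hinf HT Hover.
split=> [f|phi phi_mono /(riesz_basis_of_lower_bound Hnorm he)[C fC]].
  split; first exact/rcvgP/Tvan.
  have [S [_ adj]] := adjoint_exists Hnorm he HT.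
  rewrite (adjointE Hnorm adj); apply/rcvgP.
  exact: adjoint_orbit_vanishes Hinf Hover.1 adj.
have phi_ge n : (n <= phi n)%N.
  by elim: n => // n IH; exact: leq_ltn_trans IH (phi_mono _ _ (ltnSn n)).
have C0 : 0 < C.
  have := fC 0%N; rewrite ltNge; apply: contraTN => C0; rewrite -ltNge.
  by rewrite (le_lt_trans _ ltr01) // mulr_le0_ge0 // rnorm_ge0.
have C0' : 0 < C^-1 by rewrite invr_gt0.
(* Once the orbit of [f0] is below [C^-1], the term of index [phi N >= N] violates the lower bound
   [1 <= C * rnorm] of a Riesz sequence. *)
have [N hN] := Tvan f0 _ C0'.
have := hN _ (phi_ge N); rewrite subr0 -[C^-1]mulr1 ltr_pdivlMl //.
by rewrite ltNge fC.
Qed.
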